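(* Let $\phi\colon R\to R'$ be a strong homomorphism of (Krasner) hyperrings and define the map $\phi_*\colon \mathtt{Prim}(R')\to\mathtt{Prim}(R)$ by $\phi_*(\mathfrak p)=\phi^{-1}(\mathfrak p)$ for $\mathfrak p\in\mathtt{Prim}(R')$. Then $\phi_*$ is a continuous map of hyperstructure spaces.
   Context: For a nonempty set $H$, $\mathcal P^*(H)$ is the set of nonempty subsets of $H$. A canonical hypergroup $(H,+,0)$ is a nonempty set $H$ with a hyperoperation $+\colon H\times H\to\mathcal P^*(H)$ and $0\in H$ (with $A+B=\bigcup_{a\in A,b\in B}(a+b)$ for subsets, and elements identified with singletons) such that for all $a,b,c\in H$: $a+b=b+a$; $a+(b+c)=(a+b)+c$; $a+0=\{a\}$; there is a unique $-a\in H$ with $0\in a-a:=a+(-a)$; and $a\in b+c$ implies $c\in -b+a$ and $b\in a-c$. A (Krasner) hyperring $R$ is a canonical hypergroup $(R,+,0)$ with an associative binary (single-valued) multiplication such that $a0=0a=0$, $a(b+c)=ab+ac$, $(a+b)c=ac+bc$; a multiplicative identity and commutativity are not assumed. A strong hyperring homomorphism $\phi\colon R\to R'$ satisfies $\phi(a+b)=\phi(a)+\phi(b)$ (equality of sets), $\phi(ab)=\phi(a)\phi(b)$, $\phi(0)=0$. A subhypergroup is a nonempty subset $S$ with $x-y\subseteq S$ for all $x,y\in S$. A hyperideal of $R$ is a subhypergroup $\mathfrak a$ with $ra\in\mathfrak a$ and $ar\in\mathfrak a$ for all $r\in R$, $a\in\mathfrak a$. A (right) $R$-hypermodule is a canonical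 hypergroup $M$ with a map $M\times R\to M$, $(m,r)\mapsto mr$, such that $(m+m')r=mr+m'r$, $m(r+r')=mr+mr'$, $m(rr')=(mr)r'$, $m0=0$. A subhypermodule is a subhypergroup $S$ of $M$ with $sr\in S$ for all $s\in S$, $r\in R$. $M$ is simple if $MR\neq 0$ (i.e. $mr\ne0$ for some $m\in M,r\in R$) and its only subhypermodules are $0$ and $M$. $\mathtt{Ann}_R(M)=\{r\in R\mid mr=0\text{ for all }m\in M\}$. A proper hyperideal of $R$ is primitive if it equals $\mathtt{Ann}_R(M)$ for some simple $R$-hypermodule $M$; $\mathtt{Prim}(R)$ is the set of primitive hyperideals. The hyperstructure space is $\mathtt{Prim}(R)$ with the topology (Jacobson topology) given by the closure operator $\mathtt{Cl}(S)=\{\mathfrak p\in\mathtt{Prim}(R)\mid \mathfrak p\supseteq\mathcal K_S\}$, $\mathcal K_S=\bigcap_{\mathfrak q\in S}\mathfrak q$ (with $\mathcal K_\emptyset=R$).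
   Formalization: That φ⁻¹(𝔭) is primitive for every 𝔭 in Prim(R'), so that φ_* is defined, is assumed; it fails for some strong homomorphisms, e.g. the zero map Q→Q (φ⁻¹(0)=Q is not proper) or Z→Q (φ⁻¹(0)=0 is not primitive in Z). *)

(* Defs.v *)
From HB Require Import structures.
From mathcomp Require Import all_boot all_order.
From mathcomp Require Import mathcomp_extra boolp classical_sets functions filter.
From mathcomp Require Import topology.

Set Implicit Arguments.
Unset Strict Implicit.
Unset Printing Implicit Defensive.

Local Open Scope classical_set_scope.

(* The empty set is excluded as a value of the hyperoperation by [hadd_neq0]. *)
HB.mixin Record isCanonicalHypergroup (H : Type) := {
  hzero : H;
  hopp : H -> H;
  hadd : H -> H -> set H;
  hadd_neq0 : forall a b : H, hadd a b !=set0;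
  haddC : forall a b : H, hadd a b = hadd b a;
  haddA : forall a b c : H,
    \bigcup_(x in hadd b c) hadd a x = \bigcup_(x in hadd a b) hadd x c;
  haddx0 : forall a : H, hadd a hzero = [set a];
  haddxN : forall a : H, hadd a (hopp a) hzero;
  hopp_unique : forall a b : H, hadd a b hzero -> b = hopp a;
  hadd_reversible : forall a b c : H,
    hadd b c a -> hadd (hopp b) a c /\ hadd a (hopp c) b;
}.

#[short(type="canonicalHypergroupType")]
HB.structure Definition CanonicalHypergroup := {H of isCanonicalHypergroup H}.

Arguments hzero {s}.

HB.mixin Record CanonicalHypergroup_isHyperring (R : Type)
    & CanonicalHypergroup R := {
  hmul : R -> R -> R;
  hmulA : forall a b c : R, hmul a (hmul b c) = hmul (hmul a b) c;
  hmulx0 : forall a : R, hmul a hzero = hzero;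
  hmul0x : forall a : R, hmul hzero a = hzero;
  hmulDr : forall a b c : R,
    hmul a @` hadd b c = hadd (hmul a b) (hmul a c);
  hmulDl : forall a b c : R,
    hmul^~ c @` hadd a b = hadd (hmul a c) (hmul b c);
}.

#[short(type="hyperringType")]
HB.structure Definition Hyperring :=
  {R of CanonicalHypergroup R & CanonicalHypergroup_isHyperring R}.

HB.mixin Record CanonicalHypergroup_isHypermodule (R : hyperringType) (M : Type)
    & CanonicalHypergroup M := {
  hact : M -> R -> M;
  hactDl : forall (m m' : M) (r : R),
    hact^~ r @` hadd m m' = hadd (hact m r) (hact m' r);
  hactDr : forall (m : M) (r r' : R),
    hact m @` hadd r r' = hadd (hact m r) (hact m r');
  hactA : forall (m : M) (r r' : R), hact m (hmul r r') = hact (hact m r) r';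
  hactx0 : forall m : M, hact m hzero = hzero;
}.

#[short(type="hypermodType")]
HB.structure Definition Hypermodule (R : hyperringType) :=
  {M of CanonicalHypergroup M & CanonicalHypergroup_isHypermodule R M}.

Definition strong_hom (R R' : hyperringType) (phi : R -> R') : Prop :=
  [/\ forall a b : R, phi @` hadd a b = hadd (phi a) (phi b),
      forall a b : R, phi (hmul a b) = hmul (phi a) (phi b)
    & phi hzero = hzero].

Definition subhypergroup (H : canonicalHypergroupType) (S : set H) : Prop :=
  S !=set0 /\ forall x y : H, S x -> S y -> hadd x (hopp y) `<=` S.

Definition hyperideal (R : hyperringType) (I : set R) : Prop :=
  subhypergroup I /\ forall r a : R, I a -> I (hmul r a) /\ I (hmul a r).

Definition subhypermodule (R : hyperringType) (M : hypermodType R)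
    (S : set M) : Prop :=
  subhypergroup S /\ forall (s : M) (r : R), S s -> S (hact s r).

Definition simple_hypermodule (R : hyperringType) (M : hypermodType R) : Prop :=
  (exists (m : M) (r : R), hact m r <> hzero) /\
  forall S : set M, subhypermodule S -> S = [set hzero] \/ S = setT.

Definition Ann (R : hyperringType) (M : hypermodType R) : set R :=
  [set r | forall m : M, hact m r = hzero].

Definition primitive (R : hyperringType) (I : set R) : Prop :=
  [/\ hyperideal I, I <> setT
    & exists M : hypermodType R, simple_hypermodule M /\ I = Ann M].

Definition Prim (R : hyperringType) : Type := {I : set R | primitive I}.

HB.instance Definition _ (R : hyperringType) := gen_eqMixin (Prim R).
HB.instance Definition _ (R : hyperringType) := gen_choiceMixin (Prim R).

(* [kernel set0] is the whole of [R]. *)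
Definition kernel (R : hyperringType) (S : set (Prim R)) : set R :=
  \bigcap_(q in S) sval q.

Definition Jacobson_cl (R : hyperringType) (S : set (Prim R)) : set (Prim R) :=
  [set p | kernel S `<=` sval p].

Section JacobsonTopology.
Context {R : hyperringType}.

Lemma primitive_prime (I : set R) (x y : R) : primitive I ->
  ~ I x -> ~ I y -> exists r : R, ~ I (hmul (hmul x r) y).
Proof.
move=> [_ _ [M [[[m0 [r0 m0r0]] Msimple] ->]]] /existsNP[m mx] /existsNP[n ny].
have act0 (r : R) : hact (hzero : M) r = hzero.
  by rewrite -[in LHS](hactx0 (s := M) hzero) -hactA hmul0x hactx0.
have actN (u : M) (r : R) : hact u (hopp r) = hopp (hact u r).
  apply: hopp_unique; rewrite -hactDr.
  by exists hzero; [exact: haddxN | exact: hactx0].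
have actNl (u : M) (r : R) : hact (hopp u) r = hopp (hact u r).
  apply: hopp_unique; rewrite -hactDl.
  by exists hzero; [exact: haddxN | exact: act0].
have add00 : hadd hzero (hopp hzero) = [set (hzero : M)].
  have <- : (hzero : M) = hopp hzero.
    by apply: hopp_unique; rewrite haddx0.
  by rewrite haddx0.
have Tsub : subhypermodule [set u : M | forall r : R, hact u r = hzero].
  split; first split; first by exists hzero.
    move=> u v /= u0 v0 w uvw r.
    have : (hact^~ r @` hadd u (hopp v)) (hact w r) by exists w.
    by rewrite hactDl actNl u0 v0 add00.
  by move=> u r /= u0 r'; rewrite u0 act0.
have Ssub : subhypermodule [set hact (hact m x) r | r in [set: R]].
  split; first split; first by exists (hact (hact m x) hzero); exists hzero.
    move=> _ _ /= [r _ <-] [s _ <-] w.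
    by rewrite -actN -hactDr => -[t _ <-]; exists t.
  by move=> _ r /= [s _ <-]; exists (hmul s r) => //; rewrite hactA.
case: (Msimple _ Ssub) => [S0|ST]; last first.
  have : [set hact (hact m x) r | r in [set: R]] n by rewrite ST.
  by move=> [r _ nE]; exists r => /(_ m); rewrite !hactA nE.
case: (Msimple _ Tsub) => [T0|TT].
  exfalso; apply: mx.
  suff : [set u : M | forall r : R, hact u r = hzero] (hact m x) by rewrite T0.
  move=> r; suff : [set hact (hact m x) r | r in [set: R]] (hact (hact m x) r).
    by rewrite S0.
  by exists r.
exfalso; apply: m0r0.
by move/seteqP: TT => [_ /(_ m0 Logic.I)]; apply.
Qed.

Lemma subset_Jacobson_cl (S : set (Prim R)) : S `<=` Jacobson_cl S.
Proof. by move=> p Sp x; apply. Qed.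

Lemma Jacobson_clS (S T : set (Prim R)) :
  S `<=` T -> Jacobson_cl S `<=` Jacobson_cl T.
Proof. by move=> ST p Sp x Tx; apply: Sp => q /ST; exact: Tx. Qed.

Lemma Jacobson_cl0 : Jacobson_cl (set0 : set (Prim R)) = set0.
Proof.
apply/seteqP; split=> // p; rewrite /Jacobson_cl/= /kernel bigcap_set0.
by move=> Tp; case: (svalP p) => _ + _; apply; apply/seteqP; split.
Qed.

Lemma Jacobson_clK (S : set (Prim R)) :
  Jacobson_cl (Jacobson_cl S) = Jacobson_cl S.
Proof.
apply/seteqP; split; last exact: subset_Jacobson_cl.
by move=> p Sp x Sx; apply: Sp => q; apply.
Qed.

Lemma Jacobson_clU (S T : set (Prim R)) :
  Jacobson_cl (S `|` T) = Jacobson_cl S `|` Jacobson_cl T.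
Proof.
apply/seteqP; split; last first.
  by move=> p [] ; apply: Jacobson_clS => q; [left | right].
move=> p STp; apply: contrapT => /not_orP[].
move=> /existsNP[x /not_implyP[Sx px]] /existsNP[y /not_implyP[Ty py]].
have [r] := primitive_prime (svalP p) px py; apply; apply: STp => q [Sq|Tq].
- have [[_ Iq] _ _] := svalP q.
  by have := (Iq r x (Sx q Sq)).2 => /(Iq y)[].
- by have [[_ Iq] _ _] := svalP q; have [] := Iq (hmul x r) y (Ty q Tq).
Qed.

Definition Jacobson_open : set (set (Prim R)) :=
  [set O | Jacobson_cl (~` O) = ~` O].

Lemma Jacobson_openT : Jacobson_open setT.
Proof. by rewrite /Jacobson_open/= setCT Jacobson_cl0. Qed.

Lemma Jacobson_openI : setI_closed Jacobson_open.
Proof.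
by move=> A B; rewrite /Jacobson_open/= setCI Jacobson_clU => -> ->.
Qed.

Lemma Jacobson_open_bigU (I : Type) (f : I -> set (Prim R)) :
  (forall i, Jacobson_open (f i)) -> Jacobson_open (\bigcup_i f i).
Proof.
move=> fo; rewrite /Jacobson_open/= setC_bigcup.
apply/seteqP; split; last exact: subset_Jacobson_cl.
move=> p clp i _; rewrite -(fo i).
by apply: Jacobson_clS clp => q; apply.
Qed.

HB.instance Definition _ := isOpenTopological.Build (Prim R)
  Jacobson_openT Jacobson_openI Jacobson_open_bigU.

Lemma closure_Jacobson (S : set (Prim R)) : closure S = Jacobson_cl S.
Proof.
have closedP (C : set (Prim R)) : closed C <-> Jacobson_cl C = C.
  have opE : open (~` C) = Jacobson_open (~` C) by [].
  by rewrite -openC opE /Jacobson_open/= setCK.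
rewrite closureE; apply/seteqP; split.
- apply: smallest_sub; last exact: subset_Jacobson_cl.
  by apply/closedP; exact: Jacobson_clK.
- by move=> p Sp C [/closedP CE SC]; rewrite -CE; exact: (Jacobson_clS SC).
Qed.

End JacobsonTopology.

(* Main.v *)
(* Pulling back along phi turns the hull of a set [A] of elements of [R] into
   the hull of its image [phi @` A], so preimages of closed sets are closed. *)
Require Import Defs.
From mathcomp Require Import all_boot all_order.
From mathcomp Require Import mathcomp_extra boolp classical_sets functions filter.
From mathcomp Require Import topology.

Set Implicit Arguments.
Unset Strict Implicit.
Unset Printing Implicit Defensive.

Local Open Scope classical_set_scope.

(** Let [C] be closed with kernel [K]. Then [phi] maps [K] into every [q] with [phi_star q] in [C],
    hence into every [p] in the closure of the preimage of [C]. So [phi_star p] contains [K] and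
    lies in the closure of [C], which is [C]. The type of [phi_star] carries the primitivity of the
    preimages. *)

Theorem proposition4p10 (R R' : hyperringType) (phi : R -> R')
    (phi_hom : strong_hom phi)
    (phi_star : Prim R' -> Prim R)
    (phi_starE : forall p : Prim R', sval (phi_star p) = phi @^-1` sval p) :
  continuous phi_star.
Proof.
apply/continuousP => O Oo.
have OE : Jacobson_cl (~` O) = ~` O by exact: Oo.
suff : Jacobson_open (phi_star @^-1` O) by [].
apply/seteqP; split; last exact: subset_Jacobson_cl.
move=> p clp; suff : (~` O) (phi_star p) by [].
(* By [clp], [phi x] is in [p] once it is in every [q] that [phi_star] sends outside [O]. *)
rewrite -OE => x Kx; rewrite phi_starE; apply: clp => q nOq.
by have := Kx _ nOq; rewrite phi_starE.
Qed.
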